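(* Let $X$ be a complete geodesic space, and let $1<p<\infty$ and $0<\beta\le 1$. Assume that a closed set $E\subset X$ satisfies the $(\beta,p)$-capacity density condition. Then there exists $0<\delta<\min\{\beta,p-1\}$ such that $E$ satisfies the $(\gamma,q)$-capacity density condition for all $\beta-\delta<\gamma\le 1$ and all $p-\delta<q<\infty$.
   Context: Standing assumptions: $X=(X,d,\mu)$ is a metric measure space with $\#X\ge 2$, equipped with a metric $d$ and a positive complete Borel measure $\mu$ (extended as a Borel regular outer measure) such that $0<\mu(B)<\infty$ for all balls $B$. Balls are open sets $B(x,r)=\{y\in X: d(y,x)<r\}$ with $r>0$ (given with their center and radius), $tB=B(x,tr)$ for $B=B(x,r)$ and $t>0$, and $\overline{A}$ is the closure of $A$. The measure $\mu$ is doubling: there is a constant $c_\mu>1$ with $\mu(2B)\le c_\mu\,\mu(B)$ for all balls $B$. $X$ is a geodesic space if every pair of points can be joined by a (rectifiable, continuous) curve whose length equals the distance between the two points. $\beta$-H\''older functions: $u:X\to\mathbb{R}$ is $\beta$-H\''older ($0<\beta\le 1$) if there is $0\le\kappa<\infty$ with $|u(x)-u(y)|\le\kappa\,d(x,y)^\beta$ for all $x,y\in X$. Haj{\l}asz gradients: for $u:X\to\mathbb{R}$ and $0<\beta\le1$, $\mathcal{D}_H^\beta(u)$ is the family of all measurable $g:X\to[0,\infty]$ for which there is a set $N$ with $\mu(N)=0$ such that $|u(x)-u(y)|\le d(x,y)^\beta(g(x)+g(y))$ for all $x,y\in X\setminus N$. Capacity: let $1\le p<\infty$, $0<\beta\le1$,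 and let $\Omega\subset X$ be open. For $F\subset\Omega$ with $\mathrm{dist}(F,X\setminus\Omega)>0$, $$\mathrm{cap}_{\beta,p}(F,\Omega)=\inf_u\inf_g\int_X g(x)^p\,d\mu(x),$$ where the infimums are over all $\beta$-H\''older functions $u$ in $X$ with $u\ge1$ in $F$ and $u=0$ in $X\setminus\Omega$, and over all $g\in\mathcal{D}_H^\beta(u)$. Capacity density condition: a closed set $E\subset X$ satisfies the $(\beta,p)$-capacity density condition ($1\le p<\infty$, $0<\beta\le1$) if there is a constant $c_0>0$ such that $$\mathrm{cap}_{\beta,p}(E\cap\overline{B(x,r)},B(x,2r))\ge c_0\,r^{-\beta p}\mu(B(x,r))$$ for all $x\in E$ and all $0<r<(1/8)\operatorname{diam}(E)$. *)

(* Defs.v *)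
From HB Require Import structures.
From mathcomp Require Import all_boot all_order all_algebra.
From mathcomp Require Import all_classical all_reals all_analysis.
From mathcomp Require Import measurable_realfun.

Set Implicit Arguments.
Unset Strict Implicit.
Unset Printing Implicit Defensive.

Import Order.TTheory GRing.Theory Num.Theory.
Import numFieldNormedType.Exports.

Local Open Scope classical_set_scope.
Local Open Scope ring_scope.

#[short(type="pointedMetricType")]
HB.structure Definition PointedMetric (R : realType) :=
  { T of Metric R T & Pointed T }.

#[short(type="completeMetricType")]
HB.structure Definition CompleteMetric (R : realType) :=
  { T of Metric R T & Complete T }.

(* A metric and a sigma-algebra on the same carrier; their compatibility is
   part of metric_measure_space below. *)
#[short(type="metricMeasurableType")]
HB.structure Definition MetricMeasurable (R : realType) (d : measure_display) :=
  { T of PointedMetric R T & Measurable d T }.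

#[short(type="completeMetricMeasurableType")]
HB.structure Definition CompleteMetricMeasurable (R : realType)
    (d : measure_display) :=
  { T of MetricMeasurable R d T & Complete T }.

Section metric.
Context {R : realType} {X : metricType R}.

(* Takes values in [0, +oo] for nonempty A; the supremum over set0 is -oo. *)
Definition diam (A : set X) : \bar R :=
  ereal_sup [set (mdist x y)%:E | x in A & y in A].

(* The metric-valued analogue of the library's variation. *)
Definition curve_variation (a b : R) (c : R -> X) (s : seq R) : R :=
  let F := c \o nth b (a :: s) in
  \sum_(0 <= n < size s) mdist (F n) (F n.+1).

Definition curve_length (a b : R) (c : R -> X) : \bar R :=
  ereal_sup [set (curve_variation a b c s)%:E | s in itv_partition a b].

(* Rectifiability is implied, since the length is equated to a real number. *)
Definition geodesic_space : Prop :=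
  forall x y : X, exists (a b : R) (c : R -> X),
    [/\ a <= b, {within `[a, b], continuous c}, c a = x, c b = y
      & curve_length a b c = (mdist x y)%:E].

Definition holder_function (beta : R) (u : X -> R) : Prop :=
  exists2 k : R, 0 <= k &
    forall x y : X, `|u x - u y| <= k * mdist x y `^ beta.

End metric.
Arguments geodesic_space {R} X.

Section metric_measure.
Context {R : realType} {d : measure_display} {X : metricMeasurableType R d}.
Variable mu : {measure set X -> \bar R}.

(* mu_ext mu is the extension of mu to an outer measure on all subsets. *)
Definition borel_regular : Prop :=
  forall A : set X, exists B : set X,
    [/\ <<s @open X >> B, A `<=` B & mu B = mu_ext mu A].

Record metric_measure_space : Prop := {
  mms_two_points : exists x y : X, x != y ;
  mms_borel : forall U : set X, open U -> measurable U ;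
  mms_complete : measure_is_complete mu ;
  mms_regular : borel_regular ;
  mms_ball : forall (x : X) (r : R), 0 < r ->
    (0%:E < mu (ball x r) < +oo)%E
}.

Definition doubling : Prop :=
  exists2 c : R, 1 < c & forall (x : X) (r : R), 0 < r ->
    (mu (ball x (2 * r)) <= c%:E * mu (ball x r))%E.

Definition hajlasz_gradient (beta : R) (u : X -> R) : set (X -> \bar R) :=
  [set g : X -> \bar R | [/\ forall x, (0%:E <= g x)%E,
      measurable_fun [set: X] g
    & exists2 N : set X, mu.-negligible N & forall x y, ~ N x -> ~ N y ->
      (`|u x - u y|%:E <= (mdist x y `^ beta)%:E * (g x + g y))%E] ].

Definition cap_admissible (beta : R) (F Omega : set X) : set (X -> R) :=
  [set u | [/\ holder_function beta u, forall x, F x -> 1 <= u x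
    & forall x, ~ Omega x -> u x = 0] ].

(* Written as a total function of F and Omega; it is the capacity of the
   condenser when Omega is open, F `<=` Omega and dist(F, ~` Omega) > 0.  These
   hold for every pair in capacity_density below, where the distance is at
   least r. *)
Definition capacity (beta p : R) (F Omega : set X) : \bar R :=
  ereal_inf
    [set ereal_inf
        [set (\int[mu]_x (g x `^ p))%E | g in hajlasz_gradient beta u]
    | u in cap_admissible beta F Omega].

Definition capacity_density (beta p : R) (E : set X) : Prop :=
  exists2 c0 : R, 0 < c0 & forall (x : X) (r : R), E x -> 0 < r ->
    (r%:E < (1 / 8)%:E * diam E)%E ->
    ((c0 * r `^ (- (beta * p)))%:E * mu (ball x r)
      <= capacity beta p (E `&` closure (ball x r)) (ball x (2 * r)))%E.

End metric_measure.

(* Main.v *)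
(* Fix z in E, a small radius r, and let F be the part of E in the closed ball
   B(z,r).  Testing the capacity with the logarithmic cutoff
   log(r / dist(., F)) / (n log 2), truncated at scale 2^-n r, gives
     c0 <= C n^-p sum_(k < n) (t_k / r)^(-beta p) mu(F_(t_k)) / mu(B(z,r)),
   where t_k = 2^-k r and F_t is the t-neighborhood of F.  Since p > 1, taking n
   large forces one of the n terms to exceed any prescribed constant L.  If L
   beats the powers of the doubling constant lost when F_t is replaced by the
   balls of a separated net (z_i) in F, then for a fixed s < beta p and some
   t = t_k, 1 <= k <= n, sum_i t^-s mu(B(z_i,t)) >= r^-s mu(B(z,r)).

   Let now gamma q > s, let u be admissible for the (gamma, q)-capacity and g a
   gradient of u.  By pigeonhole over the disjoint balls of the net, a bound
   \int_B(z,4r) g^q <= V r^-s mu(B(z,r)) is inherited, with the same V, by one of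
   the balls B(z_i,t).  Iterating gives points x_j converging to E with
   g(x_j) <= (2V)^(1/q) t_j^(-s/q); as gamma > s/q the increments of u along
   them sum to O(V^(1/q)), so u cannot rise from 0 outside B(z,2r) to 1 on E
   unless V is bounded below.  A point at distance exactly 3r from z, where u
   vanishes, comes from a geodesic. *)

Require Import Defs.
From HB Require Import structures.
From mathcomp Require Import all_boot all_order all_algebra.
From mathcomp Require Import all_classical all_reals all_analysis.
From mathcomp Require Import measurable_realfun.
From mathcomp Require Import ring lra.

Set Implicit Arguments.
Unset Strict Implicit.
Unset Printing Implicit Defensive.

Import Order.TTheory GRing.Theory Num.Theory.
Import numFieldNormedType.Exports.

Local Open Scope classical_set_scope.
Local Open Scope ring_scope.

(** * Powers and logarithms *)

(** Divided by [1 + t], each of [1] and [t] lies in [0, 1] and so is at most its own [b]-th power;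
    the two quotients sum to 1. *)
Lemma powR_add1_le (R : realType) (b t : R) : 0 < b <= 1 -> 0 <= t ->
  (1 + t) `^ b <= 1 + t `^ b.
Proof.
move=> /andP[b0 b1]; rewrite le_eqVlt => /predU1P[<-|t0].
  by rewrite powR0 ?gt_eqF// addr0 powR1.
have w0 : 0 < 1 + t by lra.
have h (x : R) : 0 < x -> x <= 1 + t -> x / (1 + t) * (1 + t) `^ b <= x `^ b.
  move=> x0 x1; rewrite -[in leRHS](divfK (lt0r_neq0 w0) x).
  rewrite powRM ?divr_ge0 ?(ltW w0) ?(ltW x0)//; apply: ler_wpM2r; first exact: powR_ge0.
  by apply: ger1_powR => //; rewrite divr_gt0//= ler_pdivrMr// mul1r.
have := lerD (h 1 ltr01 ltac:(lra)) (h t t0 ltac:(lra)).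
by rewrite powR1 -mulrDl -mulrDl divff ?lt0r_neq0// mul1r.
Qed.

Lemma ln_diff_le (R : realType) (b x y : R) : 0 < b <= 1 -> 0 < x -> x <= y ->
  ln y - ln x <= b^-1 * ((y - x) `^ b * x `^ (- b)).
Proof.
move=> b01 x0 xy; have /andP[b0 b1] := b01.
have y0 : 0 < y by lra.
pose t := (y - x) / x.
have t0 : 0 <= t by rewrite divr_ge0 ?subr_ge0// ltW.
have -> : ln y - ln x = ln (1 + t).
  by rewrite -ln_div ?posrE// /t mulrBl divff ?lt0r_neq0//; congr ln; ring.
have -> : (y - x) `^ b * x `^ (- b) = t `^ b.
  by rewrite /t powRM ?subr_ge0 ?invr_ge0 ?(ltW x0)// -powR_inv1 ?(ltW x0)// -powRrM mulN1r.
rewrite mulrC ler_pdivlMr// mulrC -ln_powR.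
have := powR_add1_le b01 t0; have := powR_ge0 t b => tb0 h.
apply: (@le_trans _ _ (ln (1 + t `^ b))); last by apply: le_ln1Dx; lra.
by rewrite ler_ln ?posrE ?powR_gt0//; lra.
Qed.

(** * Metric and measure preliminaries *)

Section metric_facts.
Context {R : realType} {X : metricType R}.
Implicit Types (x y z : X) (r : R).

Lemma ball_mdist x r y : ball x r y = (mdist x y < r) :> Prop.
Proof. by rewrite ballEmdist. Qed.

Lemma open_ball x r : open (ball x r).
Proof.
rewrite openE => y; rewrite ball_mdist => xy.
apply/(@metricType_numDomainType.nbhs_mdistP R X).
exists (r - mdist x y) => /=; first by rewrite subr_gt0.
move=> w /= yw; rewrite ball_mdist.
by apply: (le_lt_trans (metric_triangle x y w)); lra.
Qed.

Lemma closure_ball_mdist x r y : closure (ball x r) y -> mdist x y <= r.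
Proof.
move=> cy; apply/ler_addgt0Pr => e e0.
have [w []] := cy _ (nbhsx_ballx y e e0).
rewrite !ball_mdist => xw yw; rewrite metric_sym in yw.
by apply: (le_trans (metric_triangle x w y)); lra.
Qed.

Lemma mdist_diff_le x y z : `|mdist z x - mdist z y| <= mdist x y.
Proof.
have := metric_triangle z x y; have := metric_triangle z y x.
by rewrite (metric_sym y x) ler_norml; lra.
Qed.

Lemma continuous_mdist z : continuous (mdist z : X -> R).
Proof.
move=> x; apply/cvgrPdist_le => e e0; near=> y.
apply: (le_trans (mdist_diff_le x y z)).
have : ball x e y by near: y; exact: nbhsx_ballx.
by rewrite ball_mdist => /ltW.
Unshelve. all: by end_near. Qed.

(** Intermediate value theorem for the distance to [z] along a geodesic from [z] to [w]. *)
Lemma geodesic_sphere (z w : X) (r : R) : geodesic_space X ->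
  0 <= r -> r <= mdist z w -> exists y, mdist z y = r.
Proof.
move=> geo r0 rzw; have [a [b [c [ab cc ca cb _]]]] := geo z w.
have cf : {within `[a, b], continuous (mdist z \o c)}.
  move=> t; exact: (@continuous_comp (subspace `[a, b]) X R c _ t (cc t)
    (@continuous_mdist z (c t))).
have [|t _ <-] := IVT (v := r) ab cf; last by exists (c t).
by rewrite /= ca cb mdistxx ge_min le_max r0 rzw orbT.
Qed.

End metric_facts.

Section measure_facts.
Context {d : measure_display} {T : measurableType d} {R : realType}.
Variable mu : {measure set T -> \bar R}.
Local Open Scope ereal_scope.

Lemma measure_bigsetU_le (I : choiceType) (s : seq I) (F : I -> set T) :
  (forall i, measurable (F i)) ->
  mu (\big[setU/set0]_(i <- s) F i) <= \sum_(i <- s) mu (F i).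
Proof.
move=> mF; elim: s => [|i s ih]; first by rewrite !big_nil measure0.
rewrite !big_cons; apply: le_trans.
  by apply: measureU2 => //; exact: bigsetU_measurable.
by rewrite leeD2l.
Qed.

Lemma sum_integral_disjoint_le (I : choiceType) (s : seq I) (F : I -> set T)
    (A : set T) (h : T -> \bar R) :
  (forall i, measurable (F i)) -> measurable A -> uniq s ->
  (forall i, i \in s -> F i `<=` A) -> trivIset [set` s] F ->
  measurable_fun A h -> (forall x, 0 <= h x) ->
  \sum_(i <- s) \int[mu]_(x in F i) h x <= \int[mu]_(x in A) h x.
Proof.
move=> mF mA us FA tF mh h0.
have DA : \big[setU/set0]_(i <- s) F i `<=` A.
  by rewrite -bigcup_seq; exact: bigcup_sub.
have mD : measurable (\big[setU/set0]_(i <- s) F i) by exact: bigsetU_measurable.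
rewrite -(ge0_integral_bigsetU mu mF us tF) //.
  by apply: ge0_subset_integral.
exact: measurable_funS mh.
Qed.

(** Otherwise [h > 2 V] almost everywhere in [A], and the integral would be at least [2 V mu A],
    which exceeds [V mu A] because [mu A] is positive and finite. *)
Lemma exists_le_average (A N : set T) (h : T -> \bar R) (V : R) :
  measurable A -> 0 < mu A -> mu A < +oo -> mu.-negligible N ->
  measurable_fun A h -> (forall x, 0 <= h x) -> (0 < V)%R ->
  \int[mu]_(x in A) h x <= V%:E * mu A ->
  exists x, [/\ A x, ~ N x & h x <= (2 * V)%:E].
Proof.
move=> mA A0 Aoo [N' [mN' N'0 NN']] mh h0 V0 hV.
apply: contrapT => /forallNP noh.
have big x : (A `\` N') x -> (2 * V)%:E <= h x.
  move=> [Ax nN]; apply: ltW; rewrite ltNge; apply/negP => hx.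
  by apply: (noh x); split => // /NN'.
have mAN : measurable (A `\` N') by exact: measurableD.
have : (2 * V)%:E * mu A <= V%:E * mu A.
  apply: le_trans hV.
  have <- : mu (A `\` N') = mu A.
    rewrite measureD//; transitivity (mu A - 0); last by rewrite sube0.
    congr (_ - _).
    apply/eqP; rewrite -measure_le0 -N'0; apply: le_measure; rewrite ?inE//.
    exact: measurableI.
  rewrite -integral_cst//.
  apply: (@le_trans _ _ (\int[mu]_(x in A `\` N') h x)); last first.
    by apply: ge0_subset_integral => //; exact: subDsetl.
  apply: ge0_le_integral => //.
  - by move=> x _; rewrite lee_fin; lra.
  - by apply: measurable_funS mh => //; exact: subDsetl.
have fA : mu A \is a fin_num by rewrite ge0_fin_numE// ltW.
rewrite -(fineK fA) -!EFinM lee_fin.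
have : (0 < fine (mu A))%R by rewrite fine_gt0// A0.
by nra.
Qed.

End measure_facts.

Lemma exists_exp2_gt (R : realType) (a : R) : exists k : nat, a < 2 ^+ k.
Proof.
exists (Num.truncn a).+1; apply: (lt_trans (truncnS_gt a)).
by rewrite -natrX ltr_nat ltn_expl.
Qed.

Definition neighborhood {R : realType} {X : metricType R} (F : set X) (t : R) :
  set X := \bigcup_(y in F) ball y t.

(** * Doubling measures: comparison of balls, separated sets and nets *)

Section doubling_facts.
Context {R : realType} {d : measure_display} {X : metricMeasurableType R d}.
Variables (mu : {measure set X -> \bar R}) (c : R).
Hypotheses (hX : metric_measure_space mu) (c1 : 1 < c).
Hypothesis hc : forall (x : X) (r : R), 0 < r ->
  (mu (ball x (2 * r)) <= c%:E * mu (ball x r))%E.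

Local Notation m x r := (fine (mu (ball x r))).

Let c0 : 0 < c. Proof. exact: lt_trans c1. Qed.

Lemma measurable_ball (x : X) (r : R) : measurable (ball x r).
Proof. by apply: (mms_borel hX); exact: open_ball. Qed.

Lemma mu_ballE (x : X) (r : R) : 0 < r -> mu (ball x r) = (m x r)%:E.
Proof.
move=> /(mms_ball hX x) /andP[_ oo].
by rewrite fineK// ge0_fin_numE.
Qed.

Lemma mu_ball_gt0 (x : X) (r : R) : 0 < r -> 0 < m x r.
Proof. by move=> /(mms_ball hX x) ?; exact: fine_gt0. Qed.

Lemma mu_ball_le (x y : X) (r s : R) : 0 < r -> mdist y x + r <= s ->
  m x r <= m y s.
Proof.
move=> r0 yxs; have s0 : 0 < s by have := mdist_ge0 y x; lra.
rewrite -lee_fin -!mu_ballE//; apply: le_measure.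
- by rewrite inE; exact: measurable_ball.
- by rewrite inE; exact: measurable_ball.
- move=> w; rewrite !ball_mdist => xw.
  by apply: (le_lt_trans (metric_triangle y x w)); lra.
Qed.

Lemma mu_ball_doubling (k : nat) (x : X) (r : R) : 0 < r ->
  m x (2 ^+ k * r) <= c ^+ k * m x r.
Proof.
move=> r0; elim: k => [|k ih]; first by rewrite !expr0 !mul1r.
have kr0 : 0 < 2 ^+ k * r by rewrite mulr_gt0// exprn_gt0.
have k2r0 : 0 < 2 * (2 ^+ k * r) by rewrite mulr_gt0.
have := hc x kr0; rewrite (mu_ballE x kr0) (mu_ballE x k2r0).
rewrite -EFinM lee_fin mulrA -exprS => /le_trans; apply.
by rewrite exprS -mulrA; apply: ler_wpM2l => //; exact: ltW.
Qed.

(** The balls of radius [delta / 2] about the points are disjoint and lie in [ball z (r + delta)].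
    Doubling any of them [k] times covers this large ball, so each carries at least the fraction
    [c ^- k] of its measure. *)
Lemma separated_card (z : X) (r delta : R) : 0 < r -> 0 < delta ->
  exists N : nat, forall s : seq X, uniq s ->
    (forall x, x \in s -> mdist z x <= r) ->
    {in s &, forall x y, x != y -> delta <= mdist x y} -> (size s <= N)%N.
Proof.
move=> r0 d0; have [k hk] := exists_exp2_gt ((2 * r + delta) / (delta / 2)).
rewrite ltr_pdivrMr ?divr_gt0// in hk.
exists (Num.truncn (c ^+ k)) => s us sr sd.
have rd0 : 0 < r + delta by lra.
have e0 : 0 < delta / 2 by lra.
have ck0 : 0 < c ^+ k by rewrite exprn_gt0.
have m0 := mu_ball_gt0 z rd0.
have : (\sum_(x <- s) \int[mu]_(y in ball x (delta / 2)) (cst 1%E y)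
        <= \int[mu]_(y in ball z (r + delta)) (cst 1%E y))%E.
  apply: sum_integral_disjoint_le => //.
  - by move=> x; exact: measurable_ball.
  - exact: measurable_ball.
  - move=> x /sr zx w; rewrite !ball_mdist => xw.
    by apply: (le_lt_trans (metric_triangle z x w)); lra.
  - move=> x y /= xs ys [w []]; rewrite !ball_mdist => xw yw.
    apply/eqP/negP => /negP xy; have := sd _ _ xs ys xy.
    by have := metric_triangle x w y; rewrite (metric_sym w y); lra.
rewrite integral_cst; last exact: measurable_ball.
rewrite mul1e (eq_bigr (fun x => (m x (delta / 2))%:E)); last first.
  move=> x _; rewrite integral_cst; last exact: measurable_ball.
  by rewrite mul1e (mu_ballE x e0).
rewrite (mu_ballE z rd0) sumEFin lee_fin => hs.
have : (size s)%:R * (m z (r + delta) / c ^+ k) <= m z (r + delta).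
  apply: le_trans hs.
  rewrite mulrC mulr_natr -sum1_size -sumrMnr (big_seq_cond xpredT).
  rewrite [leRHS]big_seq; under eq_bigl do rewrite andbT.
  apply: ler_sum => x /sr zx; rewrite mulr1n ler_pdivrMr// mulrC.
  apply: (le_trans _ (mu_ball_doubling k x e0)).
  by apply: mu_ball_le => //; rewrite metric_sym; lra.
rewrite mulrCA ger_pMr// ler_pdivrMr// mul1r => h.
by rewrite truncn_ge_nat// ltW.
Qed.

(** A separated list in [F] that is not a net can be extended by one point; without any net there
    would be separated lists of every length, against [separated_card]. *)
Lemma separated_net (F : set X) (z : X) (r delta : R) : 0 < r -> 0 < delta ->
  (forall x, F x -> mdist z x <= r) ->
  exists s : seq X, [/\ uniq s, forall x, x \in s -> F x,
    {in s &, forall x y, x != y -> delta <= mdist x y}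
    & forall y, F y -> exists2 x, x \in s & mdist x y < delta].
Proof.
move=> r0 d0 Fr; have [N hN] := separated_card z r0 d0.
apply: contrapT => /forallNP nonet.
suff grow n : exists s : seq X, [/\ uniq s, forall x, x \in s -> F x,
    {in s &, forall x y, x != y -> delta <= mdist x y} & size s = n].
  have [s [us sF sd sN]] := grow N.+1.
  by have := hN s us (fun x xs => Fr x (sF x xs)) sd; rewrite sN ltnn.
elim: n => [|n [s [us sF sd <-]]]; first by exists [::]; split.
have [y [Fy yd]] : exists y, F y /\ forall x, x \in s -> delta <= mdist x y.
  apply: contrapT => /forallNP h; apply: (nonet s); split => // y Fy.
  apply: contrapT => /forall2NP hy; apply: (h y); split => // x xs.
  by rewrite leNgt; apply/negP; have [] := hy x.
have ys : y \notin s.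
  by apply/negP => /yd; rewrite mdistxx leNgt d0.
exists (y :: s); split => //=; first by rewrite ys.
- by move=> x; rewrite inE => /predU1P[->|/sF].
- move=> x w; rewrite !inE => /predU1P[->|xs] /predU1P[->|ws].
  + by rewrite eqxx.
  + by rewrite metric_sym => _; exact: yd.
  + by move=> _; exact: yd.
  + exact: sd.
Qed.

Lemma mu_neighborhood_net_le (F : set X) (s : seq X) (delta t : R) :
  0 < delta -> 0 < t ->
  (forall y, F y -> exists2 x, x \in s & mdist x y < delta) ->
  (mu (neighborhood F t) <= (\sum_(x <- s) m x (delta + t))%:E)%E.
Proof.
move=> d0 t0 net.
have mB (x : X) : measurable (ball x (delta + t)) by exact: measurable_ball.
apply: (@le_trans _ _ (mu (\big[setU/set0]_(x <- s) ball x (delta + t)))).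
  apply: le_measure; rewrite ?inE.
  - by apply: (mms_borel hX); apply: bigcup_open => y _; exact: open_ball.
  - exact: bigsetU_measurable.
  - move=> w [y Fy]; rewrite ball_mdist => yw; have [x xs xy] := net y Fy.
    rewrite -bigcup_seq; exists x => //; rewrite ball_mdist.
    by apply: (le_lt_trans (metric_triangle x y w)); lra.
rewrite -sumEFin; apply: (le_trans (measure_bigsetU_le mu s mB)).
by apply: lee_sum => x _; rewrite -mu_ballE//; lra.
Qed.

End doubling_facts.

(** The radii tested in [capacity_density]. Smaller positive radii remain admissible, so descending
    through the scales never leaves this range. *)
Definition admissible_radius {R : realType} {X : metricType R} (E : set X)
  (r : R) : Prop := 0 < r /\ (r%:E < (1 / 8)%:E * diam E)%E.

(** * Thick sets and descent through the scales *)

Section scale_descent.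
Context {R : realType} {d : measure_display} {X : metricMeasurableType R d}.
Variables (mu : {measure set X -> \bar R}) (E : set X).

Local Notation m x r := (fine (mu (ball x r))).

(** A lower bound of Minkowski content type, in codimension [a], at one of finitely many dyadic
    scales. [0 < k] forces the scale to drop, and [k <= n] keeps the drop bounded. *)
Definition thick_within (a L : R) (n : nat) : Prop :=
  forall (z : X) (r : R), E z -> admissible_radius E r ->
  exists k : nat, (0 < k <= n)%N /\
    ((L * 2 `^ (- (a * k%:R)) * m z r)%:E <=
      mu (neighborhood (E `&` closure (ball z r)) (r * 2 `^ (- k%:R))))%E.

(** The same [V] occurs in hypothesis and conclusion, so the step can be iterated without loss. [h]
    will be the power [g ^ q] of a gradient. *)
Definition density_descends (s : R) (n : nat) : Prop :=
  forall (h : X -> \bar R) (V : R) (z : X) (t : R),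
  measurable_fun setT h -> (forall x, 0 <= h x)%E -> 0 < V ->
  E z -> admissible_radius E t ->
  (\int[mu]_(x in ball z (4 * t)) h x <= (V * t `^ (- s) * m z t)%:E)%E ->
  exists z' (k : nat), let t' := t * 2 `^ (- k%:R) in
    [/\ E z', mdist z z' <= t, (0 < k <= n)%N &
      (\int[mu]_(x in ball z' (4 * t')) h x <= (V * t' `^ (- s) * m z' t')%:E)%E].

Variable c : R.
Hypotheses (hX : metric_measure_space mu) (c1 : 1 < c).
Hypothesis hc : forall (x : X) (r : R), 0 < r ->
  (mu (ball x (2 * r)) <= c%:E * mu (ball x r))%E.

(** In the constant [3 * c ^+ 4], the power of [c] pays for shrinking the net balls from radius
    [9 t'] to [t'], and 3 beats the factor of at most 2 lost in replacing the exponent [a] by [s],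
    as [(a - s) * k <= 1]. *)
Lemma thick_density_descends (a s : R) (n : nat) :
  s <= a -> (a - s) * n%:R <= 1 ->
  thick_within a (3 * c ^+ 4) n -> density_descends s n.
Proof.
move=> sa asn thick h V z t mh h0 V0 Ez adm hV.
have [k [/andP[k0 kn] hk]] := thick z t Ez adm.
have [t0 _] := adm.
set e := 2 `^ (- k%:R) in hk *; have e0 : 0 < e by exact: powR_gt0.
have e2 : 2 * e <= 1.
  have : e <= 2 `^ (- 1) by apply: ler_powR; [lra|rewrite lerN2 ler1n].
  by rewrite powR_inv1//; lra.
set F := E `&` closure (ball z t) in hk.
pose t' := t * e; have t'0 : 0 < t' by rewrite mulr_gt0.
have t't : 2 * t' <= t by rewrite /t'; nra.
have c40 : 0 < c ^+ 4 by rewrite exprn_gt0// (lt_trans _ c1).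
apply: contrapT => no.
have [S [uS SF Ssep Snet]] := @separated_net R d X mu c hX c1 hc F z t (8 * t')
  t0 ltac:(lra) (fun x Fx => closure_ball_mdist Fx.2).
have mB (x : X) (r : R) : measurable (ball x r) by exact: (measurable_ball hX).
have big x : x \in S -> ((V * t' `^ (- s) * m x t')%:E <=
    \int[mu]_(y in ball x (4 * t')) h y)%E.
  move=> /SF Fx; apply: ltW; rewrite ltNge; apply/negP => hx; apply: no.
  by exists x, k; split => //; [exact: Fx.1|exact: closure_ball_mdist Fx.2|rewrite k0].
(* The [8 t']-separation makes the balls of radius [4 t'] disjoint; they lie in [ball z (4 * t)]
   since their centers are within [t] of [z] and [2 t' <= t]. *)
have sumle : (\sum_(x <- S) \int[mu]_(y in ball x (4 * t')) h y
    <= \int[mu]_(y in ball z (4 * t)) h y)%E.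
  apply: sum_integral_disjoint_le => //.
  - move=> x /SF[_ /closure_ball_mdist zx] w; rewrite !ball_mdist => xw.
    by apply: (le_lt_trans (metric_triangle z x w)); lra.
  - move=> x y /= xS yS [w []]; rewrite !ball_mdist => xw yw.
    apply/eqP/negP => /negP xy; have := Ssep _ _ xS yS xy.
    by have := metric_triangle x w y; rewrite (metric_sym w y); lra.
  - exact: measurable_funS mh.
have {big sumle hV} : V * t' `^ (- s) * \sum_(x <- S) m x t' <=
    V * t `^ (- s) * m z t.
  rewrite -lee_fin; apply: le_trans hV; apply: le_trans sumle.
  rewrite mulr_sumr -sumEFin big_seq [leRHS]big_seq.
  by apply: lee_sum => x; exact: big.
have {hk} : 3 * c ^+ 4 * 2 `^ (- (a * k%:R)) * m z t <=
    c ^+ 4 * \sum_(x <- S) m x t'.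
  rewrite -lee_fin; apply: (le_trans hk).
  apply: (le_trans (mu_neighborhood_net_le hX _ t'0 Snet)); first lra.
  rewrite lee_fin mulr_sumr; apply: ler_sum => x _.
  apply: le_trans (mu_ball_doubling hX c1 hc 4 x t'0).
  by apply: (mu_ball_le hX); rewrite ?mdistxx; lra.
have t's : t' `^ (- s) = t `^ (- s) * 2 `^ (s * k%:R).
  by rewrite powRM ?(ltW t0) ?(ltW e0)// /e -powRrM mulrNN (mulrC s).
have akE : 2 `^ (- (a * k%:R)) = (2 `^ (a * k%:R))^-1 by rewrite powRN.
rewrite t's akE.
have ts0 : 0 < t `^ (- s) by exact: powR_gt0.
have A0 : 0 < 2 `^ (a * k%:R) :> R by exact: powR_gt0.
have B0 : 0 < 2 `^ (s * k%:R) :> R by exact: powR_gt0.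
have AB : 2 `^ (a * k%:R) <= 2 * 2 `^ (s * k%:R) :> R.
  have -> : a * k%:R = (a - s) * k%:R + s * k%:R by ring.
  rewrite powRD ?pnatr_eq0 ?implybT//; apply: ler_wpM2r; first exact: powR_ge0.
  rewrite -[leRHS]powRr1//; apply: ler_powR; first lra.
  by apply: le_trans asn; apply: ler_wpM2l; [lra|rewrite ler_nat].
have m0 := mu_ball_gt0 hX z t0.
move: (m z t) (\sum_(x <- S) _) (2 `^ (a * k%:R)) (2 `^ (s * k%:R))
  (t `^ (- s)) (c ^+ 4) m0 A0 B0 AB ts0 c40 => M Sg A B T C M0 A0 B0 AB T0 C0.
have -> : 3 * C / A * M = C * (3 * M / A) by field; lra.
rewrite ler_pM2l// ler_pdivrMr// => h1.
have -> : V * (T * B) * Sg = (V * T) * (B * Sg) by ring.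
rewrite ler_pM2l ?mulr_gt0// => h2.
(* Here [3 M <= A Sg], [A <= 2 B] and [B Sg <= M] would give [3 M <= 2 M], while [M > 0]. *)
by nra.
Qed.

End scale_descent.

(** * The distance to a set *)

Definition set_dist {R : realType} {X : metricType R} (F : set X) (x : X) : R :=
  inf [set mdist x y | y in F].

Section set_distance.
Context {R : realType} {X : metricType R}.
Variables (F : set X) (z : X).
Hypothesis Fz : F z.

Let has_inf_dist (x : X) : has_inf [set mdist x y | y in F].
Proof.
by split; [exists (mdist x z), z|exists 0 => _ [y _ <-]; exact: mdist_ge0].
Qed.

Lemma set_dist_lip (x y : X) : set_dist F x <= set_dist F y + mdist x y.
Proof.
rewrite -lerBlDr; apply: lb_le_inf; first by case: (has_inf_dist y).
move=> _ [w Fw <-]; rewrite lerBlDr addrC.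
apply: le_trans (metric_triangle x y w).
by apply: ge_inf; [case: (has_inf_dist x)|exists w].
Qed.

Lemma set_dist_lt (x : X) (t : R) : set_dist F x < t -> neighborhood F t x.
Proof.
move=> xt; have [_ [y Fy <-] yt] := inf_lt (has_inf_dist x).1 xt.
by exists y => //; rewrite ball_mdist metric_sym.
Qed.

Lemma set_dist_mem (x : X) : F x -> set_dist F x <= 0.
Proof.
by move=> Fx; apply: ge_inf; [case: (has_inf_dist x)|exists x; rewrite ?mdistxx].
Qed.

End set_distance.

(** * The logarithmic cutoff *)

Section log_cutoff.
Context {R : realType} {X : metricType R}.
Variables (F : set X) (z : X) (r : R) (n : nat).
Hypotheses (Fz : F z) (r0 : 0 < r) (n0 : (0 < n)%N).

Let eps := r * 2 `^ (- n%:R).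

(** The lower clamp [eps] keeps the logarithm finite on [F]; the upper clamp [r] makes the cutoff
    vanish far from [F]. *)
Definition clamped_dist (x : X) : R := Num.min r (Num.max (set_dist F x) eps).

(** The denominator is [ln (r / eps)], which normalizes the value on [F] to 1. *)
Definition log_cutoff (x : X) : R :=
  (ln r - ln (clamped_dist x)) / (n%:R * ln 2).

Let eps0 : 0 < eps. Proof. by rewrite mulr_gt0// powR_gt0. Qed.

Let epsr : eps <= r.
Proof.
rewrite /eps -[leRHS]mulr1; apply: ler_wpM2l; first exact: ltW.
by rewrite -[leRHS](powRr0 2); apply: ler_powR; rewrite ?oppr_le0 ?ler1n.
Qed.

Let L0 : 0 < n%:R * ln 2 :> R.
Proof. by rewrite mulr_gt0 ?ltr0n// ln_gt0// ltr1n. Qed.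

Lemma clamped_dist_ge x : eps <= clamped_dist x.
Proof. by rewrite /clamped_dist le_min epsr le_max lexx orbT. Qed.

Lemma clamped_dist_gt0 x : 0 < clamped_dist x.
Proof. exact: lt_le_trans (clamped_dist_ge x). Qed.

Lemma clamped_dist_le x : clamped_dist x <= r.
Proof. by rewrite /clamped_dist ge_min lexx. Qed.

Lemma clamped_dist_lip x y : clamped_dist y - clamped_dist x <= mdist x y.
Proof.
have := set_dist_lip Fz y x; rewrite (metric_sym y x) lerBlDr => h.
have := mdist_ge0 x y => d0.
rewrite /clamped_dist addrC addr_minl le_min !ge_min !ge_max.
apply/andP; split; first by rewrite lerDl d0.
apply/orP; right; rewrite addr_maxl !le_max h/=.
by rewrite lerDl d0 orbT.
Qed.

(** Take [k] with [set_dist F x] below the [k]-th dyadic radius such that either [k + 1 = n], where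
    the clamp [eps] is the lower bound, or the next radius is no longer above the distance. *)
Lemma clamped_dist_shell x : clamped_dist x < r -> exists k, [/\ (k < n)%N,
  neighborhood F (r * 2 `^ (- k%:R)) x & r * 2 `^ (- k.+1%:R) <= clamped_dist x].
Proof.
move=> xr; pose P k := set_dist F x < r * 2 `^ (- k%:R).
have P0 : P 0%N.
  rewrite /P oppr0 powRr0 mulr1 ltNge; apply/negP => rd.
  by move: xr; rewrite /clamped_dist min_l ?ltxx// le_max rd.
have [k [kn Pk hk]] : exists k, [/\ (k < n)%N, P k & k.+1 = n \/ ~ P k.+1].
  elim: n n0 => // j ih _; have [->|j0] := posnP j; first by exists 0%N; split=> //; left.
  have [k [kj Pk [kE|nP]]] := ih j0; last by exists k; split; [exact: ltnW|by []|right].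
  have [Pj|nPj] := pselect (P j); first by exists j; split => //; left.
  by exists k; split; [exact: ltnW|by []|right; rewrite kE].
exists k; split => //; first exact: (set_dist_lt Fz).
case: hk => [->|/negP nP]; first exact: clamped_dist_ge.
rewrite /clamped_dist le_min le_max; apply/andP; split.
  rewrite -[leRHS]mulr1; apply: ler_wpM2l; first exact: ltW.
  by rewrite -[leRHS](powRr0 2); apply: ler_powR; rewrite ?oppr_le0 ?ler1n.
by rewrite -leNgt in nP; rewrite nP.
Qed.

Lemma log_cutoff_mem x : F x -> log_cutoff x = 1.
Proof.
move=> /(set_dist_mem Fz) Fx.
have -> : log_cutoff x = (ln r - ln eps) / (n%:R * ln 2).
  by rewrite /log_cutoff /clamped_dist max_r ?min_r// (le_trans Fx)// ltW.
rewrite /eps lnM ?posrE ?powR_gt0// ln_powR mulNr opprD addNKr opprK.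
by rewrite divff// lt0r_neq0.
Qed.

Lemma log_cutoff_far x : r <= set_dist F x -> log_cutoff x = 0.
Proof.
by move=> rx; rewrite /log_cutoff /clamped_dist min_l ?le_max ?rx// subrr mul0r.
Qed.

(** The coefficient involves only the point nearer to [F], so a gradient need only be large there.
    The factor [n] in the denominator is the gain of the logarithm. *)
Lemma log_cutoff_diff_le (b : R) x y : 0 < b <= 1 ->
  clamped_dist x <= clamped_dist y ->
  `|log_cutoff x - log_cutoff y| <=
    mdist x y `^ b * ((b * (n%:R * ln 2))^-1 * clamped_dist x `^ (- b)).
Proof.
move=> b01 xy; have /andP[b0 b1] := b01.
have x0 := clamped_dist_gt0 x.
rewrite /log_cutoff -mulrBl normrM.
have -> : ln r - ln (clamped_dist x) - (ln r - ln (clamped_dist y)) =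
  ln (clamped_dist y) - ln (clamped_dist x) by ring.
rewrite (gtr0_norm (x := _^-1)) ?invr_gt0// ger0_norm; last first.
  by rewrite subr_ge0 ler_ln// posrE; exact: lt_le_trans xy.
have := ln_diff_le b01 x0 xy => h.
have {}h : ln (clamped_dist y) - ln (clamped_dist x) <=
    b^-1 * (mdist x y `^ b * clamped_dist x `^ (- b)).
  apply: (le_trans h); apply: ler_wpM2l; first by rewrite invr_ge0 ltW.
  apply: ler_wpM2r; first exact: powR_ge0.
  apply: ge0_ler_powR; rewrite ?nnegrE ?mdist_ge0 ?subr_ge0// ?(ltW b0)//.
  exact: clamped_dist_lip.
have -> : mdist x y `^ b * ((b * (n%:R * ln 2))^-1 * clamped_dist x `^ (- b))
  = b^-1 * (mdist x y `^ b * clamped_dist x `^ (- b)) * (n%:R * ln 2)^-1.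
  by rewrite (invfM b); ring.
by apply: ler_wpM2r => //; rewrite invr_ge0 ltW.
Qed.

Lemma log_cutoff_holder (b : R) : 0 < b <= 1 -> holder_function b log_cutoff.
Proof.
move=> b01; have /andP[b0 b1] := b01.
have k0 : 0 <= (b * (n%:R * ln 2))^-1 by rewrite invr_ge0 mulr_ge0// ltW.
exists ((b * (n%:R * ln 2))^-1 * eps `^ (- b)); first by rewrite mulr_ge0// powR_ge0.
suff h x y : clamped_dist x <= clamped_dist y ->
    `|log_cutoff x - log_cutoff y| <=
    (b * (n%:R * ln 2))^-1 * eps `^ (- b) * mdist x y `^ b.
  move=> x y; have [xy|/ltW yx] := leP (clamped_dist x) (clamped_dist y).
    exact: h.
  by rewrite distrC metric_sym; exact: h.
move=> xy; apply: (le_trans (log_cutoff_diff_le b01 xy)).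
rewrite mulrC; apply: ler_wpM2r; first exact: powR_ge0.
apply: ler_wpM2l => //; rewrite !powRN lef_pV2 ?posrE ?powR_gt0//; last exact: clamped_dist_gt0.
apply: ge0_ler_powR; rewrite ?nnegrE ?(ltW b0) ?(ltW eps0)//.
  exact/ltW/clamped_dist_gt0.
exact: clamped_dist_ge.
Qed.

End log_cutoff.

(** Take [g] to be the [l^p] sum of the steps [a k] on [A k]: it dominates each step, and the
    integral of its [p]-th power splits exactly. *)
Lemma exists_step_majorant {d : measure_display} {T : measurableType d}
    {R : realType} (mu : {measure set T -> \bar R}) (n : nat) (p : R)
    (a : nat -> R) (A : nat -> set T) :
  0 < p -> (forall k, 0 <= a k) -> (forall k, measurable (A k)) ->
  exists g : T -> R, [/\ forall x, 0 <= g x, measurable_fun setT g,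
    forall k x, (k < n)%N -> A k x -> a k <= g x
    & (\int[mu]_x ((g x)%:E `^ p) = \sum_(k < n) (a k `^ p)%:E * mu (A k))%E].
Proof.
move=> p0 a0 mA.
pose G (x : T) : R := \sum_(k < n) a k `^ p * \1_(A k) x.
have t0 x (k : 'I_n) : 0 <= a k `^ p * \1_(A k) x.
  by rewrite mulr_ge0 ?powR_ge0// indicE ler0n.
have mI k : measurable_fun setT (\1_(A k) : T -> R) by exact: measurable_indic.
have mG : measurable_fun setT G.
  apply: measurable_sum => k; apply: measurable_funM; first exact: measurable_cst.
  exact: mI.
have p_neq0 : p != 0 by exact: lt0r_neq0.
exists (fun x => G x `^ p^-1); split.
- by move=> x; exact: powR_ge0.
- exact: (measurableT_comp (measurable_powR p^-1) mG).
- move=> k x kn Ax.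
  have -> : a k = (a k `^ p) `^ p^-1 by rewrite -powRrM divff// powRr1.
  apply: ge0_ler_powR; rewrite ?nnegrE ?powR_ge0 ?invr_ge0 ?(ltW p0)//.
    by apply: sumr_ge0 => j _; exact: t0.
  have ik : \1_(A k) x = 1 :> R by rewrite indicE mem_set.
  rewrite /G (bigD1 (Ordinal kn) isT) [nat_of_ord _]/= ik (mulr1 (a k `^ p)).
  by rewrite lerDl; apply: sumr_ge0 => j _; exact: t0.
- have gp x : ((G x `^ p^-1)%:E `^ p =
      \sum_(k < n) (a k `^ p)%:E * (\1_(A k) x)%:E)%E.
    rewrite poweR_EFin -powRrM mulVf// powRr1; last first.
      by apply: sumr_ge0 => j _; exact: t0.
    by rewrite /G -sumEFin; apply: eq_bigr => k _; rewrite EFinM.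
  rewrite (eq_integral _ _ (fun x _ => gp x)) ge0_integral_sum//; last 2 first.
  + move=> k; apply: emeasurable_funM; first exact: measurable_cst.
    by apply/measurable_EFinP; exact: mI.
  + by move=> k x _; rewrite mule_ge0// lee_fin ?powR_ge0// indicE ler0n.
  apply: eq_bigr => k _; have i0 x : setT x -> (0 <= (\1_(A k) x : R)%:E)%E.
    by rewrite lee_fin indicE ler0n.
  have mk : measurable_fun setT (fun x => (\1_(A k) x : R)%:E).
    by apply/measurable_EFinP; exact: mI.
  by rewrite ge0_integralZl_EFin ?powR_ge0// integral_indic// setIT.
Qed.

(** * The capacity bound given by the cutoff *)

Section log_cutoff_capacity.
Context {R : realType} {d : measure_display} {X : metricMeasurableType R d}.
Variable mu : {measure set X -> \bar R}.
Hypothesis hX : metric_measure_space mu.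

Lemma measurable_neighborhood (F : set X) (t : R) : measurable (neighborhood F t).
Proof. by apply: (mms_borel hX); apply: bigcup_open => y _; exact: open_ball. Qed.

(** The assumed decay of the neighborhoods cancels the growth of the gradient, so each of the [n]
    shells contributes the same amount, of order [n ^ (- p)]. *)
Lemma capacity_log_cutoff_le (F : set X) (z : X) (r b p M : R) (n : nat) :
  0 < b <= 1 -> 1 < p -> 0 < r -> (0 < n)%N -> F z ->
  (forall y, F y -> mdist z y <= r) ->
  (forall k, (k < n)%N ->
    (mu (neighborhood F (r * 2 `^ (- k%:R))) <= (M * 2 `^ (- (b * p * k%:R)))%:E)%E) ->
  (capacity mu b p F (ball z (2 * r)) <=
    (n%:R * (b * (n%:R * ln 2)) `^ (- p) * 2 `^ (b * p) * r `^ (- (b * p)) * M)%:E)%E.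
Proof.
move=> b01 p1 r0 n0 Fz Fr hM; have /andP[b0 b1] := b01.
have L0 : 0 < n%:R * ln 2 :> R by rewrite mulr_gt0 ?ltr0n// ln_gt0// ltr1n.
have bL0 : 0 < b * (n%:R * ln 2) by rewrite mulr_gt0.
set u := log_cutoff F r n.
pose a (k : nat) := (b * (n%:R * ln 2))^-1 * (r * 2 `^ (- k.+1%:R)) `^ (- b).
have a0 k : 0 <= a k by rewrite mulr_ge0 ?powR_ge0// invr_ge0 ltW.
pose Fk k := neighborhood F (r * 2 `^ (- k%:R)).
have mFk k : measurable (Fk k) by exact: measurable_neighborhood.
have [g [g0 mg gFk intg]] :=
  exists_step_majorant mu n (lt_trans ltr01 p1) a0 mFk.
have uadm : cap_admissible b F (ball z (2 * r)) u.
  split; first exact: (log_cutoff_holder Fz r0 n0 b01).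
  - by move=> x Fx; rewrite /u (log_cutoff_mem Fz r0 n0 Fx).
  - move=> x; rewrite ball_mdist => zx; apply: log_cutoff_far.
    rewrite leNgt; apply/negP => /(set_dist_lt Fz) [y /Fr zy].
    rewrite ball_mdist => yx; apply: zx.
    by apply: (le_lt_trans (metric_triangle z y x)); lra.
have gge x : clamped_dist F r n x < r ->
    (b * (n%:R * ln 2))^-1 * clamped_dist F r n x `^ (- b) <= g x.
  move=> /(clamped_dist_shell Fz r0 n0) [k [kn xk hk]].
  have rk0 : 0 < r * 2 `^ (- k.+1%:R) by rewrite mulr_gt0// powR_gt0.
  apply: (@le_trans _ _ (a k)).
    rewrite /a; apply: ler_wpM2l; first by rewrite invr_ge0 ltW.
    have x0 : 0 < clamped_dist F r n x by exact: lt_le_trans hk.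
    rewrite !(powRN _ b) lef_pV2 ?posrE ?powR_gt0//.
    by apply: ge0_ler_powR; rewrite ?nnegrE ?(ltW b0) ?(ltW rk0) ?(ltW x0).
  exact: gFk.
have ggrad : hajlasz_gradient mu b u (EFin \o g).
  split.
  - by move=> x; rewrite lee_fin.
  - exact/measurable_EFinP.
  - exists set0; first exact: negligible_set0.
    suff h x y : clamped_dist F r n x <= clamped_dist F r n y ->
        `|u x - u y| <= mdist x y `^ b * (g x + g y).
      move=> x y _ _; rewrite -EFinD -EFinM lee_fin.
      have [xy|/ltW yx] := leP (clamped_dist F r n x) (clamped_dist F r n y).
        exact: h.
      by rewrite distrC metric_sym (addrC (g x)); exact: h.
    (* Equal clamped distances, possibly both [r], give equal values of [u]. Otherwise the smaller
       one is below [r], as [gge] requires. *)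
    rewrite le_eqVlt => /predU1P[xy|xy].
      rewrite /u /log_cutoff xy subrr normr0 mulr_ge0 ?powR_ge0//.
      exact: addr_ge0.
    apply: (le_trans (log_cutoff_diff_le Fz r0 n0 b01 (ltW xy))).
    apply: ler_wpM2l; first exact: powR_ge0.
    rewrite (le_trans (gge x _))// ?lerDl//.
    exact: (lt_le_trans xy (clamped_dist_le F r n y)).
apply: ereal_inf_le.
exists (ereal_inf [set \int[mu]_x (g' x `^ p)%E | g' in hajlasz_gradient mu b u])%E.
  by exists u.
apply: ereal_inf_le; eexists; first by exists (EFin \o g).
rewrite [leLHS]intg.
have -> : n%:R * (b * (n%:R * ln 2)) `^ (- p) * 2 `^ (b * p) * r `^ (- (b * p)) * M
  = \sum_(k < n) (b * (n%:R * ln 2)) `^ (- p) * 2 `^ (b * p) * r `^ (- (b * p)) * M.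
  by rewrite sumr_const card_ord -[RHS]mulr_natl !mulrA.
rewrite -sumEFin; apply: lee_sum => k _.
apply: (@le_trans _ _ ((a k `^ p)%:E * (M * 2 `^ (- (b * p * k%:R)))%:E)%E).
  by apply: lee_wpmul2l; [rewrite lee_fin powR_ge0|exact: hM].
rewrite -EFinM lee_fin le_eqVlt; apply/orP; left; apply/eqP.
have -> : a k `^ p = (b * (n%:R * ln 2)) `^ (- p) *
    (r `^ (- (b * p)) * 2 `^ (b * p * k.+1%:R)).
  rewrite /a (@powRM _ _^-1) ?invr_ge0 ?powR_ge0 ?(ltW bL0)//; congr (_ * _).
    by rewrite -powR_inv1 ?(ltW bL0)// -powRrM mulN1r.
  rewrite -powRrM powRM ?(ltW r0) ?powR_ge0// -powRrM mulNr; congr (_ * 2 `^ _).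
  by ring.
have -> : b * p * k.+1%:R = b * p + b * p * k%:R by rewrite -natr1; ring.
rewrite (powRN 2 (_ * k%:R)) powRD ?pnatr_eq0 ?implybT//.
have : 2 `^ (b * p * k%:R) != 0 :> R by rewrite lt0r_neq0// powR_gt0.
by move: (2 `^ (b * p * k%:R)) => C C0; field.
Qed.

End log_cutoff_capacity.

(** * From capacity density to thickness *)

Lemma exists_power_decay (R : realType) (p K c0 : R) : 1 < p -> 0 < K -> 0 < c0 ->
  exists n : nat, (0 < n)%N /\ n%:R * n%:R `^ (- p) * K < c0.
Proof.
(* The quantity is [K / n ^ (p - 1)], and [p > 1] lets it tend to 0; [x] solves
   [x ^ (p - 1) = K / c0]. *)
move=> p1 K0 c00; set x := (K / c0) `^ (p - 1)^-1.
have Kc : 0 < K / c0 by rewrite divr_gt0.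
exists (Num.truncn x).+1; split => //; set n : R := _%:R.
have n0 : 0 < n by rewrite ltr0n.
have xn : x < n by exact: truncnS_gt.
have np : K / c0 < n `^ (p - 1).
  have -> : K / c0 = x `^ (p - 1).
    by rewrite /x -powRrM mulVf ?powRr1 ?(ltW Kc)// subr_eq0 gt_eqF.
  by apply: gt0_ltr_powR; rewrite ?nnegrE ?subr_gt0 ?powR_ge0 ?(ltW n0).
have -> : n * n `^ (- p) = (n `^ (p - 1))^-1.
  rewrite -powRN opprB -[n in n * _]powRr1 ?(ltW n0)// -powRD //.
  by apply/implyP => _; exact: lt0r_neq0.
have np0 : 0 < n `^ (p - 1) by exact: powR_gt0.
by rewrite mulrC ltr_pdivrMr// mulrC -ltr_pdivrMr.
Qed.

Lemma capacity_density_thick {R : realType} {d : measure_display}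
    {X : metricMeasurableType R d} (mu : {measure set X -> \bar R}) (E : set X)
    (b p c L : R) :
  metric_measure_space mu -> 1 < c ->
  (forall (x : X) (r : R), 0 < r ->
    (mu (ball x (2 * r)) <= c%:E * mu (ball x r))%E) ->
  0 < b <= 1 -> 1 < p -> c <= L -> capacity_density mu b p E ->
  exists n, thick_within mu E (b * p) L n.
Proof.
move=> hX c1 hc b01 p1 cL [c0 c00 hcap]; have /andP[b0 b1] := b01.
have l20 : 0 < ln 2 :> R by rewrite ln_gt0// ltr1n.
have L0 : 0 < L by lra.
have bl0 : 0 < b * ln 2 by rewrite mulr_gt0.
pose K := (b * ln 2) `^ (- p) * 2 `^ (b * p) * L.
have K0 : 0 < K by rewrite /K !mulr_gt0 ?powR_gt0.
have [n [n0 hn]] := exists_power_decay p1 K0 c00.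
exists n => z r Ez [r0 rE]; apply: contrapT => /forallNP no.
set F := E `&` closure (ball z r).
have Fz : F z by split => //; apply: subset_closure; exact: ballxx.
have Fr y : F y -> mdist z y <= r by move=> [_]; exact: closure_ball_mdist.
have m0 := mu_ball_gt0 hX z r0.
set m := fine (mu (ball z r)) in m0.
have hM k : (k < n)%N -> (mu (neighborhood F (r * 2 `^ (- k%:R))) <=
    (L * m * 2 `^ (- (b * p * k%:R)))%:E)%E.
  (* For [0 < k] the bound is the negated conclusion. For [k = 0] it comes from one doubling, the
     neighborhood being inside [ball z (2 * r)]; this uses [c <= L]. *)
  move=> kn; have [->|k0] := posnP k; last first.
    rewrite mulrAC; apply: ltW; rewrite ltNge; apply/negP => h; apply: (no k).
    by rewrite k0 (ltnW kn).
  rewrite mulr0 !oppr0 !powRr0 !mulr1.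
  apply: (@le_trans _ _ (mu (ball z (2 * r)))).
    apply: le_measure; rewrite ?inE.
    - exact: (measurable_neighborhood hX).
    - exact: (measurable_ball hX).
    - move=> w [y /Fr zy]; rewrite !ball_mdist => yw.
      by apply: (le_lt_trans (metric_triangle z y w)); lra.
  apply: (le_trans (hc z r r0)); rewrite (mu_ballE hX z r0) -EFinM lee_fin.
  by apply: ler_wpM2r => //; exact: ltW.
have := le_trans (hcap z r Ez r0 rE)
  (capacity_log_cutoff_le hX b01 p1 r0 n0 Fz Fr hM).
rewrite (mu_ballE hX z r0) -/m -EFinM lee_fin.
have -> : (b * (n%:R * ln 2)) `^ (- p) = n%:R `^ (- p) * (b * ln 2) `^ (- p).
  rewrite mulrCA; exact: (powRM _ (ler0n R n) (ltW bl0)).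
rewrite leNgt => /negP; apply.
have -> : n%:R * (n%:R `^ (- p) * (b * ln 2) `^ (- p)) * 2 `^ (b * p) *
    r `^ (- (b * p)) * (L * m) =
  (n%:R * n%:R `^ (- p) * K) * r `^ (- (b * p)) * m by rewrite /K; ring.
by rewrite !ltr_pM2r// powR_gt0.
Qed.

(** If all points were within [3 r] of [z], the diameter of [E] would be at most [8 r]. *)
Lemma admissible_radius_far {R : realType} {X : metricType R} (E : set X) (z : X)
  (r : R) : E z -> admissible_radius E r -> exists w, 3 * r <= mdist z w.
Proof.
move=> Ez [r0 rE]; apply: contrapT => /forallNP far.
have : (diam E <= (8 * r)%:E)%E.
  apply: ge_ereal_sup => _ [x Ex [y Ey <-]]; rewrite lee_fin.
  have /negP := far x; have /negP := far y; rewrite -!ltNge => zy zx.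
  by have := metric_triangle x z y; rewrite (metric_sym x z); lra.
move=> hd; have h8 : (0 <= (1 / 8)%:E :> \bar R)%E by rewrite lee_fin; lra.
have := lt_le_trans rE (lee_wpmul2l h8 hd).
by rewrite -EFinM lte_fin; lra.
Qed.

(** * Chaining *)

Section hajlasz_chain.
Context {R : realType} {d : measure_display} {X : metricMeasurableType R d}.
Variables (mu : {measure set X -> \bar R}) (b q : R) (u : X -> R)
  (g : X -> \bar R) (N : set X).
Hypotheses (hX : metric_measure_space mu) (b0 : 0 < b) (q0 : 0 < q).
Hypotheses (g0 : forall x, (0 <= g x)%E) (mg : measurable_fun setT g).
Hypothesis N0 : mu.-negligible N.
Hypothesis ug : forall x y, ~ N x -> ~ N y ->
  (`|u x - u y|%:E <= (mdist x y `^ b)%:E * (g x + g y))%E.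

Local Notation m x r := (fine (mu (ball x r))).

Lemma hajlasz_diff_le (x y : X) (D A B : R) : ~ N x -> ~ N y ->
  mdist x y <= D -> (g x <= A%:E)%E -> (g y <= B%:E)%E ->
  `|u x - u y| <= D `^ b * (A + B).
Proof.
move=> Nx Ny xyD gA gB; have D0 : 0 <= D := le_trans (mdist_ge0 x y) xyD.
have A0 : 0 <= A by rewrite -lee_fin (le_trans (g0 x)).
have B0 : 0 <= B by rewrite -lee_fin (le_trans (g0 y)).
rewrite -lee_fin; apply: (le_trans (ug Nx Ny)).
apply: (@le_trans _ _ ((mdist x y `^ b)%:E * (A%:E + B%:E))%E).
  by apply: lee_wpmul2l; [rewrite lee_fin powR_ge0|exact: leeD].
rewrite -EFinD -EFinM lee_fin; apply: ler_wpM2r; first exact: addr_ge0.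
by apply: ge0_ler_powR; rewrite ?nnegrE ?mdist_ge0 ?(ltW b0).
Qed.

Lemma measurable_gradient_power : measurable_fun setT (fun x => g x `^ q)%E.
Proof. exact: (measurableT_comp (measurable_poweR q) mg). Qed.

Lemma exists_gradient_le (z : X) (t V : R) : 0 < t -> 0 < V ->
  (\int[mu]_(x in ball z t) (g x `^ q) <= (V * m z t)%:E)%E ->
  exists x, [/\ mdist z x < t, ~ N x & (g x <= ((2 * V) `^ q^-1)%:E)%E].
Proof.
move=> t0 V0; rewrite EFinM -(mu_ballE hX z t0) => hV.
have /andP[m0 moo] := mms_ball hX z t0.
have mgz : measurable_fun (ball z t) (fun x => g x `^ q)%E.
  exact: measurable_funS measurable_gradient_power.
have [x [zx Nx hx]] := exists_le_average (measurable_ball hX z t) m0 moo N0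
  mgz (fun x => poweR_ge0 (g x) q) V0 hV.
 exists x; split => //; first by rewrite -(ball_mdist z t x).
have q_neq0 := lt0r_neq0 q0.
(* The value [+oo] is excluded because its [q]-th power is again [+oo]. *)
move: (g0 x) hx; case: (g x) => [y|_|//].
  rewrite poweR_EFin !lee_fin => y0 hy.
  have -> : y = (y `^ q) `^ q^-1 by rewrite -powRrM divff// powRr1.
  apply: ge0_ler_powR; rewrite ?nnegrE ?powR_ge0 ?invr_ge0 ?(ltW q0)//.
  by rewrite mulr_ge0// ltW.
by rewrite poweRyr// leye_eq.
Qed.

Variables (E : set X) (s : R) (n : nat).
Hypotheses (s0 : 0 < s) (sbq : s < b * q) (desc : density_descends mu E s n).

Let eta := b - s / q.

Let eta0 : 0 < eta. Proof. by rewrite subr_gt0 ltr_pdivrMr. Qed.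

Definition chain_constant : R :=
  3 `^ b * (1 + 2 `^ (n%:R * (s / q))) / (1 - 2 `^ (- eta)).

Let C0 : 0 < 1 - 2 `^ (- eta) :> R.
Proof.
rewrite subr_gt0 powRN invf_lt1 ?powR_gt0//.
rewrite -[ltLHS](powRr0 2) /powR pnatr_eq0/= ltr_expR mul0r mulr_gt0//.
by rewrite ln_gt0// ltr1n.
Qed.

Lemma chain_constant_ge0 : 0 <= chain_constant.
Proof.
by rewrite /chain_constant divr_ge0 ?(ltW C0) ?mulr_ge0 ?addr_ge0 ?powR_ge0.
Qed.

(* Each link of the chain changes u by O(W t^eta), a geometric series in t
   because eta > 0. *)
Lemma hajlasz_chain (z0 x0 : X) (t0 V : R) :
  let W := (2 * V) `^ q^-1 in
  0 < V -> E z0 -> admissible_radius E t0 ->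
  (\int[mu]_(x in ball z0 (4 * t0)) (g x `^ q) <=
    (V * t0 `^ (- s) * m z0 t0)%:E)%E ->
  mdist z0 x0 < t0 -> ~ N x0 -> (g x0 <= (W * t0 `^ (- (s / q)))%:E)%E ->
  forall j : nat, exists z t x,
    [/\ E z, 0 < t, t * 2 ^+ j <= t0, mdist z0 z + 2 * t <= 2 * t0 &
     [/\ mdist z x < t, ~ N x, (g x <= (W * t `^ (- (s / q)))%:E)%E,
      (\int[mu]_(x in ball z (4 * t)) (g x `^ q) <=
        (V * t `^ (- s) * m z t)%:E)%E
      & u x <= u x0 + chain_constant * W * (t0 `^ eta - t `^ eta)]].
Proof.
move=> W V0 Ez0 [t00 t0E] hV0 zx0 Nx0 gx0.
have W0 : 0 <= W by exact: powR_ge0.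
elim=> [|j [z [t [x [Ez t_gt0 tj zt [zx Nx gx hV ux]]]]]].
  exists z0, t0, x0; split => //; first by rewrite expr0 mulr1.
    by rewrite mdistxx add0r.
  by split => //; rewrite subrr mulr0 addr0.
have j1 : 1 <= 2 ^+ j :> R by rewrite exprn_ege1// ler1n.
have tt0 : t <= t0 by nra.
have adm : admissible_radius E t.
  by split => //; apply: le_lt_trans t0E; rewrite lee_fin.
have [z' [k /= [Ez' zz' /andP[k0 kn] hV']]] :=
  desc measurable_gradient_power (fun x => poweR_ge0 (g x) q) V0 Ez adm hV.
set e := 2 `^ (- k%:R) in hV'; have e0 : 0 < e by exact: powR_gt0.
have e2 : 2 * e <= 1.
  have : e <= 2 `^ (- 1) by apply: ler_powR; [lra|rewrite lerN2 ler1n].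
  by rewrite powR_inv1//; lra.
set t' := t * e in hV'; have t'0 : 0 < t' by rewrite mulr_gt0.
have t't : 2 * t' <= t by rewrite /t'; nra.
have Vt' : 0 < V * t' `^ (- s) by rewrite mulr_gt0// powR_gt0.
have [|x' [z'x' Nx']] := exists_gradient_le (z := z') t'0 Vt'.
  apply: le_trans hV'; apply: ge0_subset_integral => //.
  - exact: (measurable_ball hX).
  - exact: (measurable_ball hX).
  - exact: measurable_funS measurable_gradient_power.
  - by move=> y _; exact: poweR_ge0.
  - by move=> y; rewrite !ball_mdist; lra.
rewrite mulrA powRM ?powR_ge0 ?mulr_ge0 ?(ltW V0)// -/W -powRrM mulNr => gx'.
exists z', t', x'; split => //.
- by rewrite exprS; have := ler_wpM2r (ltac:(lra) : 0 <= 2 ^+ j) t't; lra.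
(* The center moves by at most [t] and [2 t' <= t], so the invariant on [mdist z0 z + 2 * t] is
   kept. *)
- by have := metric_triangle z0 z z'; lra.
split => //.
have xx' : mdist x x' <= 3 * t.
  have := metric_triangle x z x'; have := metric_triangle z z' x'.
  by rewrite (metric_sym x z); lra.
have := le_trans (ler_norm _) (hajlasz_diff_le Nx' Nx _ gx' gx).
rewrite metric_sym => /(_ _ xx') dx.
set sig := s / q in gx gx' dx *.
set P := 2 `^ (n%:R * sig); set Qv := 2 `^ (- eta).
(* [k <= n] bounds the growth of the gradient over one link; [tQ] below uses [1 <= k] for the decay
   of [t ^ eta]. *)
have te : t' `^ (- sig) <= t `^ (- sig) * P.
  rewrite /t' powRM ?(ltW t_gt0) ?(ltW e0)//; apply: ler_wpM2l; first exact: powR_ge0.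
  rewrite /e -powRrM mulrNN; apply: ler_powR; first by rewrite ler1n.
  by apply: ler_wpM2r; [rewrite divr_ge0 ?(ltW s0) ?(ltW q0)|rewrite ler_nat].
have tQ : t' `^ eta <= t `^ eta * Qv.
  rewrite /t' powRM ?(ltW t_gt0) ?(ltW e0)//; apply: ler_wpM2l; first exact: powR_ge0.
  rewrite /e -powRrM; apply: ler_powR; first by rewrite ler1n.
  by rewrite mulNr lerN2 -[leLHS]mul1r; apply: ler_wpM2r; [exact: ltW|rewrite ler1n].
have tb : (3 * t) `^ b * t `^ (- sig) = 3 `^ b * t `^ eta.
  rewrite powRM ?(ltW t_gt0)// -mulrA -powRD// (gt_eqF t_gt0).
  by rewrite implybT.
have step : (3 * t) `^ b * (W * t' `^ (- sig) + W * t `^ (- sig)) <=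
    chain_constant * W * (t `^ eta - t' `^ eta).
  apply: (@le_trans _ _ (3 `^ b * t `^ eta * (W * (1 + P)))).
    rewrite -tb -!mulrA; apply: ler_wpM2l; first exact: powR_ge0.
    rewrite -mulrDr mulrCA; apply: ler_wpM2l => //.
    by rewrite mulrDr mulr1 addrC lerD2l.
  apply: (@le_trans _ _ (chain_constant * W * (t `^ eta * (1 - Qv)))).
    rewrite le_eqVlt; apply/orP; left; apply/eqP; rewrite /chain_constant -/sig -/P -/Qv.
    have : 1 - Qv != 0 by exact: lt0r_neq0.
    by move: (3 `^ b) (t `^ eta) => A B Q0; field.
  apply: ler_wpM2l; last by rewrite mulrBr mulr1 lerD2l lerN2.
  by rewrite mulr_ge0// chain_constant_ge0.
by lra.
Qed.

End hajlasz_chain.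

(** * From descent to capacity density *)

Lemma density_descends_capacity_density {R : realType} {d : measure_display}
    {X : metricMeasurableType R d} (mu : {measure set X -> \bar R}) (E : set X)
    (b q c s : R) (n : nat) :
  metric_measure_space mu -> 1 < c ->
  (forall (x : X) (r : R), 0 < r ->
    (mu (ball x (2 * r)) <= c%:E * mu (ball x r))%E) ->
  geodesic_space X -> 0 < b -> 0 < q -> 0 < s -> s < b * q ->
  density_descends mu E s n -> capacity_density mu b q E.
Proof.
move=> hX c1 hc geo b0 q0 s0 sbq desc.
have q_neq0 := lt0r_neq0 q0.
pose eta := b - s / q; have eta0 : 0 < eta by rewrite subr_gt0 ltr_pdivrMr.
pose C1 := chain_constant b q s n.
(* [C2] prices the jump from a zero of [u] to the start of the chain: distance at most [20 t0], and
   two doublings to compare the balls. *)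
pose C2 := 20 `^ b * (1 + (c ^+ 2) `^ q^-1).
have C10 : 0 <= C1 by exact: chain_constant_ge0.
have C20 : 0 < C2 by rewrite mulr_gt0 ?powR_gt0// ltr_wpDr ?powR_ge0.
have C120 : 0 < 2 * (C1 + C2) by rewrite mulr_gt0// ltr_wpDl.
have c0 : 0 < c by lra.
(* This is [V t0 ^ (b q - s)] for the [V] below, divided by [c ^+ 2] to pass from radius [r = 4 t0]
   to [t0]. *)
exists ((2 * (C1 + C2)) `^ (- q) / (2 * c ^+ 2)).
  by rewrite divr_gt0 ?powR_gt0// mulr_gt0// exprn_gt0.
move=> z r Ez r0 rE.
pose t0 := r / 4; have t00 : 0 < t0 by rewrite divr_gt0.
have rt : r = 4 * t0 by rewrite /t0; lra.
(* [W] is chosen so that the initial jump and all links together raise [u] by at most 1/2, and [V]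
   so that [(2 V) ^ (1/q) = W]. *)
pose W := t0 `^ (- eta) / (2 * (C1 + C2)).
have W0 : 0 < W by rewrite divr_gt0// powR_gt0.
pose V := W `^ q / 2; have V0 : 0 < V by rewrite divr_gt0// powR_gt0.
have WE : (2 * V) `^ q^-1 = W.
  rewrite /V mulrC divfK// -powRrM divff// powRr1//; exact: ltW.
have Wt : (C1 + C2) * (W * t0 `^ eta) = 1 / 2.
  rewrite /W powRN; have : t0 `^ eta != 0 by rewrite lt0r_neq0// powR_gt0.
  have : C1 + C2 != 0 by rewrite lt0r_neq0// ltr_wpDl.
  by move: (t0 `^ eta) (C1 + C2) => A B A0 B0; field; rewrite A0 B0.
pose m x r := fine (mu (ball x r)).
have mz0 : 0 < m z t0 by exact: mu_ball_gt0.
apply: le_ereal_inf_tmp => _ [u [[k k0 uk] uge1 uout] <-].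
apply: le_ereal_inf_tmp => _ [g [g0 mg [N N0 ug]] <-].
rewrite leNgt; apply/negP => small.
have mgq := measurable_gradient_power q mg.
have gq0 x : (0 <= g x `^ q)%E by exact: poweR_ge0.
have hV : (\int[mu]_x (g x `^ q) <= (V * t0 `^ (- s) * m z t0)%:E)%E.
  apply: (le_trans (ltW small)); rewrite (mu_ballE hX z r0) -EFinM lee_fin.
  have VE : V * t0 `^ (- s) = (2 * (C1 + C2)) `^ (- q) / 2 * t0 `^ (- (b * q)).
    rewrite /V /W powRM ?powR_ge0 ?invr_ge0 ?(ltW C120)//.
    rewrite -powR_inv1 ?(ltW C120)// -!powRrM mulN1r.
    have -> : t0 `^ (- (b * q)) = t0 `^ (- eta * q) * t0 `^ (- s).
      rewrite -powRD ?(gt_eqF t00) ?implybT//; congr (_ `^ _).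
      by rewrite /eta; field.
    by ring.
  rewrite VE.
  have mr : fine (mu (ball z r)) <= c ^+ 2 * m z t0.
    apply: le_trans (mu_ball_doubling hX c1 hc 2 z t00).
    by apply: (mu_ball_le hX) => //; rewrite mdistxx rt expr2; lra.
  have tr : r `^ (- (b * q)) <= t0 `^ (- (b * q)).
    rewrite !powRN lef_pV2 ?posrE ?powR_gt0//.
    apply: ge0_ler_powR; rewrite ?nnegrE ?(ltW t00) ?(ltW r0)//; last by lra.
    by rewrite ltW// mulr_gt0.
  have A0 : 0 <= (2 * (C1 + C2)) `^ (- q) by exact: powR_ge0.
  have B0 : 0 <= r `^ (- (b * q)) by exact: powR_ge0.
  have c20 : 0 < c ^+ 2 by rewrite exprn_gt0.
  move: mr tr A0 B0 mz0 c20.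
  move: (fine _) (m z t0) (_ `^ (- q)) (r `^ _) (t0 `^ _) (c ^+ 2)
    => M m0 A B T Cc mr tr A0 B0 m00 c20.
  apply: (@le_trans _ _ (A / (2 * Cc) * B * (Cc * m0))).
    by apply: ler_wpM2l => //; rewrite !mulr_ge0// invr_ge0 mulr_ge0// ltW.
  have -> : A / (2 * Cc) * B * (Cc * m0) = A / 2 * B * m0 by field; lra.
  apply: ler_wpM2r; first exact: ltW.
  by apply: ler_wpM2l => //; rewrite mulr_ge0// invr_ge0.
have sub (x : X) (t : R) : (\int[mu]_(y in ball x t) (g y `^ q) <=
    \int[mu]_y (g y `^ q))%E.
  apply: ge0_subset_integral => //; exact: (measurable_ball hX).
have adm : admissible_radius E t0.
  by split => //; apply: le_lt_trans rE; rewrite lee_fin; lra.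
have [w zw] := admissible_radius_far Ez (conj r0 rE).
have [y0 zy0] := geodesic_sphere geo (ltac:(lra) : 0 <= 3 * r) zw.
have Vt : 0 < V * t0 `^ (- s) by rewrite mulr_gt0// powR_gt0.
have [x0 [zx0 Nx0 gx0]] := exists_gradient_le hX q0 g0 mg N0 t00 Vt
  (le_trans (sub z t0) hV).
have Vt2 : 0 < V * t0 `^ (- s) * c ^+ 2 by rewrite mulr_gt0// exprn_gt0.
(* The ball of radius [r] about [y0] misses [ball z (2 * r)], so [u] vanishes at the point [y] found
   there. *)
have [|y [y0y Ny gy]] := exists_gradient_le (z := y0) hX q0 g0 mg N0 r0 Vt2.
  apply: (le_trans (sub _ _)); apply: (le_trans hV).
  rewrite lee_fin -(mulrA _ (c ^+ 2)); apply: ler_wpM2l; first exact: ltW.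
  apply: le_trans (mu_ball_doubling hX c1 hc 2 y0 r0).
  by apply: (mu_ball_le hX) => //; rewrite metric_sym zy0 expr2; lra.
have tsE : (t0 `^ (- s)) `^ q^-1 = t0 `^ (- (s / q)) by rewrite -powRrM mulNr.
have V20 : 0 <= 2 * V by lra.
have gx0' : (g x0 <= (W * t0 `^ (- (s / q)))%:E)%E.
  by move: gx0; rewrite mulrA (powRM _ V20 (powR_ge0 _ _)) WE tsE.
have gy' : (g y <= (W * t0 `^ (- (s / q)) * (c ^+ 2) `^ q^-1)%:E)%E.
  move: gy; have -> : 2 * (V * t0 `^ (- s) * c ^+ 2) = 2 * V * t0 `^ (- s) * c ^+ 2.
    by ring.
  rewrite (powRM _ (mulr_ge0 V20 (powR_ge0 _ _)) (exprn_ge0 2 (ltW c0))).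
  by rewrite (powRM _ V20 (powR_ge0 _ _)) WE tsE.
have tE : t0 `^ b * t0 `^ (- (s / q)) = t0 `^ eta.
  by rewrite -powRD// (gt_eqF t00) implybT.
have ux0 : u x0 <= C2 * (W * t0 `^ eta).
  have uy : u y = 0.
    apply: uout; rewrite ball_mdist => zy.
    by have := metric_triangle z y y0; rewrite (metric_sym y y0) zy0; lra.
  have x0y : mdist x0 y <= 20 * t0.
    have := metric_triangle x0 z y; have := metric_triangle z y0 y.
    by rewrite (metric_sym x0 z) zy0; lra.
  have := le_trans (ler_norm _) (hajlasz_diff_le b0 g0 ug Nx0 Ny x0y gx0' gy').
  rewrite uy subr0 => /le_trans; apply.
  rewrite powRM ?(ltW t00)// -tE /C2.
  by rewrite le_eqVlt; apply/orP; left; apply/eqP; ring.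
have := hajlasz_chain hX b0 q0 g0 mg N0 ug s0 sbq desc V0 Ez adm.
rewrite WE => /(_ _ (le_trans (sub z _) hV) zx0 Nx0 gx0') chain.
have half x t : 0 < t -> u x <= u x0 + C1 * W * (t0 `^ eta - t `^ eta) ->
    u x <= 1 / 2.
  move=> t_gt0 /le_trans; apply; rewrite -Wt.
  have CW : 0 <= C1 * W by rewrite mulr_ge0// ltW.
  have := mulr_ge0 CW (powR_ge0 t eta).
  by move: ux0; move: (t `^ eta) (t0 `^ eta) => A B; lra.
(* Within distance [tau] the function [u] varies by less than 1/2; adding 1 to [k] covers [k = 0].
   Once the chain scale is below [tau], the bound [u x <= 1 / 2] contradicts [1 <= u z']. *)
pose tau := ((2 * (k + 1))^-1) `^ b^-1.
have k10 : 0 < 2 * (k + 1) by lra.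
have tau0 : 0 < tau by rewrite powR_gt0// invr_gt0.
have [j hj] := exists_exp2_gt (t0 / tau).
have [z' [t [x [Ez' t_gt0 tj zz' [z'x _ _ _ ux]]]]] := chain j.
have uz' : 1 <= u z'.
  apply: uge1; split => //; apply: subset_closure.
  by rewrite ball_mdist; lra.
have ttau : t < tau.
  have p2 : 0 < 2 ^+ j :> R by rewrite exprn_gt0.
  by rewrite ltr_pdivrMr// in hj; rewrite -(ltr_pM2r p2) (le_lt_trans tj)// mulrC.
have tb : mdist z' x `^ b <= (2 * (k + 1))^-1.
  have -> : (2 * (k + 1))^-1 = tau `^ b.
    by rewrite /tau -powRrM mulVf ?powRr1 ?invr_ge0 ?(ltW k10)// lt0r_neq0.
  apply: ge0_ler_powR; rewrite ?nnegrE ?mdist_ge0 ?(ltW b0) ?(ltW tau0)//.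
  exact: ltW (lt_trans z'x ttau).
have := le_trans (ler_norm _) (uk z' x); have := half _ _ t_gt0 ux.
have : k * mdist z' x `^ b < 1 / 2; last by lra.
apply: (le_lt_trans (ler_wpM2l k0 tb)).
by rewrite ltr_pdivrMr//; lra.
Qed.

Theorem theorem9p6 (R : realType) (d : measure_display)
    (X : completeMetricMeasurableType R d) (mu : {measure set X -> \bar R})
    (hX : metric_measure_space mu) (hmu : doubling mu)
    (hgeo : geodesic_space X)
    (p beta : R) (hp : 1 < p) (hbeta : 0 < beta <= 1)
    (E : set X) (hE : closed E) (hcap : capacity_density mu beta p E) :
  exists delta : R, 0 < delta < Num.min beta (p - 1) /\
    forall gamma q : R, beta - delta < gamma <= 1 -> p - delta < q ->
      capacity_density mu gamma q E.
Proof.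
have [c c1 hc] := hmu; have /andP[b0 b1] := hbeta.
have c4 : 1 <= c ^+ 3 by rewrite exprn_ege1// ltW.
have cL : c <= 3 * c ^+ 4 by rewrite exprS; nra.
have [n thick] := capacity_density_thick hX c1 hc hbeta hp cL hcap.
have bp0 : 0 < beta * p by rewrite mulr_gt0//; lra.
(* The first bound keeps [s = beta * p - eps] positive; the second gives [eps * n <= 1], as the
   descent requires. *)
pose eps := Num.min (beta * p / 2) (n.+1%:R)^-1.
have eps0 : 0 < eps by rewrite lt_min divr_gt0//= invr_gt0.
have epsb : eps <= beta * p / 2 by rewrite ge_min lexx.
have epsn : eps * n%:R <= 1.
  have : eps <= (n.+1%:R)^-1 by rewrite ge_min lexx orbT.
  move=> /(ler_wpM2r (ler0n R n)) /le_trans; apply.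
  by rewrite mulrC ler_pdivrMr// mul1r ler_nat.
have desc : density_descends mu E (beta * p - eps) n.
  apply: (thick_density_descends hX c1 hc _ _ thick); first lra.
  by rewrite opprB addrC subrK.
(* The last term ensures [(beta - delta) * (p - delta) > beta * p - eps], hence [s < gamma * q]; the
   halves keep both factors positive and [delta] strictly below the minimum. *)
pose delta := Num.min (Num.min (beta / 2) ((p - 1) / 2)) (eps / (beta + p)).
have bp : 0 < beta + p by lra.
have d0 : 0 < delta.
  by rewrite !lt_min !divr_gt0// subr_gt0.
have db : delta <= beta / 2 by rewrite !ge_min lexx.
have dp : delta <= (p - 1) / 2 by rewrite !ge_min lexx orbT.
have de : delta * (beta + p) <= eps.
  by rewrite -ler_pdivlMr// !ge_min lexx orbT.
exists delta; split; first by rewrite d0 lt_min; lra.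
move=> gamma q /andP[gd g1] qd.
have s0 : 0 < beta * p - eps by lra.
have sgq : beta * p - eps < gamma * q.
  have : (beta - delta) * (p - delta) < gamma * q.
    by apply: ltr_pM => //; lra.
  by nra.
by apply: (density_descends_capacity_density hX c1 hc hgeo _ _ s0 sgq desc); lra.
Qed.
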